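(* Let $(X,d)$ be an unbounded, locally complete and incomplete metric space, and let $h$ be the hyperbolization metric on $X$, $$h(x,y)=2\log\frac{d(x,y)+\max\{d(x),d(y)\}}{\sqrt{d(x)d(y)}}\qquad (x,y\in X).$$ Let $\partial_hX$ be the Gromov boundary of the Gromov hyperbolic space $(X,h)$. Then there is a natural map $\varphi\colon\partial_hX\to\partial X\cup\{\infty\}$ and a point $\xi\in\partial_hX$ with $\varphi(\xi)=\infty$ such that, for every Busemann function $b\in\mathcal B_h(\xi)$ and every Hamenstädt metric $h_{b,\varepsilon}$ on $\partial_hX\setminus\{\xi\}$ based at $b$ with (admissible) parameter $\varepsilon$, the map $$\varphi\colon(\partial_hX\setminus\{\xi\},h_{b,\varepsilon})\to(\partial X,d)$$ is $\eta$-quasisymmetric, where the function $\eta$ depends only on $\varepsilon$.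
   Context: **Metric boundary.** For a metric space $(X,d)$, $\overline X$ is its metric completion, $\partial X=\overline X\setminus X$ (with the metric $d$ extended to $\overline X$). $X$ is incomplete if $\partial X\ne\emptyset$, and locally complete if every point has a complete neighbourhood. For $x\in X$, $d(x):=d(x,\partial X)$ is the distance from $x$ to $\partial X$; it is positive when $X$ is locally complete and incomplete. **Gromov hyperbolicity.** For a metric space $(X,m)$, $(x|y)_w=\frac12[m(x,w)+m(y,w)-m(x,y)]$. $(X,m)$ is $\delta$-hyperbolic if $(x|y)_w\ge\min\{(x|z)_w,(z|y)_w\}-\delta$ for all $x,y,z,w\in X$, and Gromov hyperbolic if this holds for some $\delta\ge0$. A sequence $\{x_i\}$ is a Gromov sequence if $(x_i|x_j)_w\to\infty$ as $i,j\to\infty$; Gromov sequences $\{x_i\},\{y_i\}$ are equivalent if $(x_i|y_i)_w\to\infty$. The Gromov boundary ($\partial_\infty X$, or $\partial_mX$ to indicate the metric $m$) is the set of equivalence classes. For $x\in X$, $\xi,\zeta\in\partial_mX$: $(x|\xi)_w=\inf\{\liminf_i(x|y_i)_w:\{y_i\}\in\xi\}$ and $(\xi|\zeta)_w=\inf\{\liminf_i(x_i|y_i)_w:\{x_i\}\in\xi,\{y_i\}\in\zeta\}$. It is known that $(X,h)$ is $\delta$-hyperbolic with $\delta=\log4$. **Busemann functions and Hamenstädt metrics.** Let $(X,m)$ be $\delta$-hyperbolic and $\xi\in\partial_mX$. A Busemann function based at $\xi$ is a function $b=b_{\xi,w}\colon X\to\mathbb R$, $b(x)=(\xi|w)_x-(\xi|x)_w$,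 for some $w\in X$; the set of these is $\mathcal B_m(\xi)$. Put $(x|y)_b=\frac12(b(x)+b(y)-m(x,y))$ for $x,y\in X$, and for $\xi_1,\xi_2\in\partial_mX\setminus\{\xi\}$, $(\xi_1|\xi_2)_b=\inf\{\liminf_i(x_i|y_i)_b:\{x_i\}\in\xi_1,\{y_i\}\in\xi_2\}$. A parameter $\varepsilon>0$ is admissible if $e^{22\varepsilon\delta}\le2$. For admissible $\varepsilon$ let $\rho_{b,\varepsilon}(\xi_1,\xi_2)=e^{-\varepsilon(\xi_1|\xi_2)_b}$ (with $e^{-\infty}=0$). The Hamenstädt metric based at $b$ with parameter $\varepsilon$ on $\partial_mX\setminus\{\xi\}$, denoted $m_{b,\varepsilon}$, is $m_{b,\varepsilon}(\xi_1,\xi_2)=\inf\sum_{i=1}^n\rho_{b,\varepsilon}(\zeta_{i-1},\zeta_i)$, the infimum over all $n\ge1$ and all chains $\xi_1=\zeta_0,\dots,\zeta_n=\xi_2$ in $\partial_mX\setminus\{\xi\}$. It is a metric with $\frac12\rho_{b,\varepsilon}\le m_{b,\varepsilon}\le\rho_{b,\varepsilon}$. **Natural maps.** For unbounded $X$, equip $\overline X\cup\{\infty\}$ with the topology whose open sets are the open sets of $\overline X$ and the sets $U\ni\infty$ whose complement is a closed bounded subset of $\overline X$. If $m$ is a metric on $X$ with $(X,m)$ Gromov hyperbolic, a map $\psi\colon\partial_mX\to\partial X\cup\{\infty\}$ is natural if it is a continuous extension of the identity map $(X,m)\to(X,d)$, i.e. the identity together with $\psi$ is continuous from $X\cup\partial_mX$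 to $\overline X\cup\{\infty\}$. Here $X\cup\partial_mX$ has its usual topology: $X$ is open with the $m$-topology, and the sets $\{z:(z|\zeta)_w>t\}$, $t>0$, form a neighbourhood base at $\zeta\in\partial_mX$. In particular $x_i\to\psi(\zeta)$ for every Gromov sequence $\{x_i\}\in\zeta$. **Quasisymmetry.** A homeomorphism $f\colon(Y,\sigma)\to(Y',\sigma')$ is $\eta$-quasisymmetric, for a homeomorphism $\eta\colon[0,\infty)\to[0,\infty)$, if $\sigma(x,y)\le t\,\sigma(x,z)$ implies $\sigma'(f(x),f(y))\le\eta(t)\,\sigma'(f(x),f(z))$ for all $t>0$ and $x,y,z\in Y$. *)

(* Defs.v *)
From HB Require Import structures.
From mathcomp Require Import all_boot all_order all_algebra.
From mathcomp Require Import all_classical all_reals all_analysis.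
From mathcomp Require Import lra.
Set Implicit Arguments.
Unset Strict Implicit.
Unset Printing Implicit Defensive.
Import Order.TTheory GRing.Theory Num.Theory.
Import numFieldNormedType.Exports.

Local Open Scope classical_set_scope.
Local Open Scope ring_scope.

Section completion.
Context {R : realType}.

Definition bounded_mset (X : metricType R) (A : set X) : Prop :=
  exists M : R, forall x y, A x -> A y -> mdist x y <= M.

Definition complete_mset (X : metricType R) (A : set X) : Prop :=
  forall F : set_system X, ProperFilter F -> cauchy F -> F A ->
    exists2 p, A p & F --> p.

Definition locally_complete (X : metricType R) : Prop :=
  forall x : X, exists2 A, nbhs x A & complete_mset A.

(* The completion of X, unique up to isometry, is represented by any complete
   space Y together with an isometric embedding iota of X with dense range. *)
Definition is_completion (X Y : metricType R) (iota : X -> Y) : Prop :=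
  [/\ complete_mset [set: Y],
      forall x y, mdist (iota x) (iota y) = mdist x y
    & dense (range iota)].

Definition mboundary (X Y : metricType R) (iota : X -> Y) : set Y :=
  ~` range iota.

Definition bdist (X Y : metricType R) (iota : X -> Y) (x : X) : R :=
  inf [set mdist (iota x) z | z in mboundary iota].

Definition hyperbolization (X Y : metricType R) (iota : X -> Y) (x y : X) : R :=
  2 * ln ((mdist x y + Num.max (bdist iota x) (bdist iota y))
          / Num.sqrt (bdist iota x * bdist iota y)).

End completion.

Section gromov.
Context {R : realType} {X : Type}.
Variable m : X -> X -> R.

Definition gromov_prod (w x y : X) : R := (m x w + m y w - m x y) / 2.

Definition gromov_hyperbolic (delta : R) : Prop :=
  forall x y z w, Num.min (gromov_prod w x z) (gromov_prod w z y) - delta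
    <= gromov_prod w x y.

(* For a metric m the next two notions do not depend on the base point w. *)
Definition gromov_seq (x : nat -> X) : Prop :=
  forall w, gromov_prod w (x ij.1) (x ij.2) @[ij --> (\oo, \oo)] --> +oo.

Definition gromov_equiv (x y : nat -> X) : Prop :=
  forall w, gromov_prod w (x i) (y i) @[i --> \oo] --> +oo.

Definition gromov_class (x : nat -> X) : set (nat -> X) :=
  [set y | gromov_seq y /\ gromov_equiv x y].

Definition gboundary : Type :=
  {C : set (nat -> X) | exists2 x, gromov_seq x & C = gromov_class x}.

Definition class_of (z : gboundary) : set (nat -> X) := proj1_sig z.

Definition gromov_prod_pb (w x : X) (z : gboundary) : \bar R :=
  ereal_inf [set limn_einf (fun i => (gromov_prod w x (y i))%:E)
            | y in class_of z].

Definition gromov_prod_bb (w : X) (z1 z2 : gboundary) : \bar R :=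
  ereal_inf [set limn_einf (fun i => (gromov_prod w (x i) (y i))%:E)
            | x in class_of z1 & y in class_of z2].

(* Both products lie between 0 and the m-distance of the two points of X,
   hence are finite. *)
Definition busemann (xi : gboundary) (w : X) : X -> R :=
  fun x => fine (gromov_prod_pb x w xi) - fine (gromov_prod_pb w x xi).

Definition busemann_functions (xi : gboundary) : set (X -> R) :=
  range (busemann xi).

Definition busemann_prod (b : X -> R) (x y : X) : R := (b x + b y - m x y) / 2.

Definition busemann_prod_bb (b : X -> R) (z1 z2 : gboundary) : \bar R :=
  ereal_inf [set limn_einf (fun i => (busemann_prod b (x i) (y i))%:E)
            | x in class_of z1 & y in class_of z2].

(* delta is any hyperbolicity constant of (X, m); for the hyperbolization metric,
   ln 4 always is one (gromov_hyperbolic_hyperbolization). *)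
Definition admissible (delta eps : R) : Prop :=
  0 < eps /\ expR (22 * eps * delta) <= 2.

Definition hamenstadt_rho (b : X -> R) (eps : R) (z1 z2 : gboundary) : \bar R :=
  expeR (- (eps%:E * busemann_prod_bb b z1 z2))%E.

Definition chain_sums (xi : gboundary) (b : X -> R) (eps : R)
    (z1 z2 : gboundary) : set (\bar R) :=
  [set s | exists (n : nat) (c : nat -> gboundary),
    [/\ (0 < n)%N, c 0%N = z1, c n = z2,
        forall i, (i <= n)%N -> c i <> xi
      & s = (\sum_(i < n) hamenstadt_rho b eps (c i) (c i.+1))%E]].

Definition hamenstadt (xi : gboundary) (b : X -> R) (eps : R)
    (z1 z2 : gboundary) : R :=
  fine (ereal_inf (chain_sums xi b eps z1 z2)).

(* (z | zeta)_w for z in the disjoint union of X and its Gromov boundary *)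
Definition gromov_prod_ub (w : X) (z : X + gboundary) (zeta : gboundary)
    : \bar R :=
  match z with
  | inl x => gromov_prod_pb w x zeta
  | inr z' => gromov_prod_bb w z' zeta
  end.

Definition gclosure_nbhs (p : X + gboundary) : set_system (X + gboundary) :=
  match p with
  | inl x => [set A | exists2 r : R, 0 < r & forall y, m x y < r -> A (inl y)]
  | inr zeta => [set A | forall w, exists2 t : R, 0 < t &
                  [set z | (t%:E < gromov_prod_ub w z zeta)%E] `<=` A]
  end.

End gromov.

Section natural_maps.
Context {R : realType}.

(* option Y is Y with a point at infinity None; the sets containing infinity
   are required to have closed bounded, not compact, complement. *)
Definition ext_open (Y : metricType R) (U : set (option Y)) : Prop :=
  (exists2 V : set Y, open V & U = Some @` V) \/
  (U None /\ exists C : set Y, [/\ closed C, bounded_mset C & ~` U = Some @` C]).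

Definition natural_map (X Y : metricType R) (iota : X -> Y) (m : X -> X -> R)
    (psi : gboundary m -> option Y) : Prop :=
  let F (p : X + gboundary m) : option Y :=
    match p with inl x => Some (iota x) | inr zeta => psi zeta end in
  (forall zeta, psi zeta = None \/ (Some @` mboundary iota) (psi zeta)) /\
  (forall p U, ext_open U -> U (F p) -> gclosure_nbhs p (F @^-1` U)).

End natural_maps.

Section quasisymmetry.
Context {R : realType}.

Definition metric_homeo (T T' : Type) (A : set T) (sigma : T -> T -> R)
    (B : set T') (sigma' : T' -> T' -> R) (f : T -> T') : Prop :=
  [/\ set_bij A B f,
      forall x, A x -> forall e, 0 < e -> exists2 r, 0 < r &
        forall y, A y -> sigma x y < r -> sigma' (f x) (f y) < e
    & forall x, A x -> forall e, 0 < e -> exists2 r, 0 < r &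
        forall y, A y -> sigma' (f x) (f y) < r -> sigma x y < e].

Definition homeo_halfline (eta : R -> R) : Prop :=
  metric_homeo `[0, +oo[ (fun s t => `|s - t|) `[0, +oo[ (fun s t => `|s - t|)
    eta.

Definition quasisymmetric (eta : R -> R) (T T' : Type)
    (A : set T) (sigma : T -> T -> R) (B : set T') (sigma' : T' -> T' -> R)
    (f : T -> T') : Prop :=
  [/\ homeo_halfline eta,
      metric_homeo A sigma B sigma' f
    & forall t x y z, 0 < t -> A x -> A y -> A z ->
        sigma x y <= t * sigma x z ->
        sigma' (f x) (f y) <= eta t * sigma' (f x) (f z)].

End quasisymmetry.

Section hyperbolization_theory.
Context {R : realType} {X Y : metricType R} (iota : X -> Y).

Lemma bdist_gt0 x : is_completion iota -> locally_complete X ->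
  mboundary iota !=set0 -> 0 < bdist iota x.
Proof.
move=> [_ iso dns] lcX incX; have [A /nbhs_ballP[r /= r0 rA] cA] := lcX x.
apply: (@lt_le_trans _ _ r) => //.
apply: lb_le_inf.
  by have [z zb] := incX; exists (mdist (iota x) z), z.
move=> _ [z zb <-]; rewrite leNgt; apply/negP => xz.
have zr : (ball (iota x) r) z by rewrite ballEmdist.
pose F : set_system X := [set B | nbhs z (~` (iota @` (~` B)))].
have FE B V : nbhs z V -> iota @^-1` V `<=` B -> F B.
  move=> zV VB; rewrite /F /=; apply: filterS zV => y Vy [u nBu uy].
  by apply: nBu; apply: VB; rewrite /= uy.
have FP B : F B -> exists2 V, nbhs z V & iota @^-1` V `<=` B.
  move=> FB; exists (~` (iota @` (~` B))) => // u nu.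
  by apply: contrapT => nBu; apply: nu; exists u.
have FF : ProperFilter F.
  apply: Build_ProperFilter_ex.
    move=> B /FP[V zV VB].
    have [|y [Vy [u _ uy]]] := dns V° _ (open_interior V).
      by exists z.
    by exists u; apply: VB; rewrite /= uy; exact: interior_subset.
  split.
  - by apply: (FE _ setT) => //; exact: filterT.
  - move=> B C /FP[V zV VB] /FP[W zW WC].
    by apply: (FE _ (V `&` W)); [exact: filterI | move=> u [/VB ? /WC ?]].
  - by move=> B C BC /FP[V zV VB]; apply: (FE _ V) => // u /VB /BC.
have Fball e : 0 < e -> F [set u | mdist (iota u) z < e].
  move=> e0; apply: (FE _ (ball z e)); first exact: nbhsx_ballx.
  by move=> u /=; rewrite ballEmdist /= metric_sym.
have FA : F A.
  have zo : nbhs z (ball (iota x) r).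
    apply/nbhs_ballP; exists (r - mdist (iota x) z); first by rewrite /= subr_gt0.
    move=> y; rewrite !ballEmdist /= => zy.
    have := metric_triangle (iota x) z y; lra.
  apply: (FE _ _ zo) => u; rewrite /= ballEmdist /= iso => xu.
  by apply: rA; rewrite ballEmdist.
have FC : cauchy F.
  apply: cauchy_exP => e e0.
  have e20 : 0 < e / 2 by rewrite divr_gt0.
  have [u /= uz] := @filter_ex _ _ FF _ (Fball _ e20).
  exists u; apply: filterS (Fball _ e20) => v /= vz.
  rewrite ballEmdist /= -iso.
  have := metric_triangle (iota u) z (iota v).
  rewrite (metric_sym z); lra.
have [a Aa Fa] := cA F FF FC FA.
apply: zb; exists a => //.
apply/eqP/negPn/negP; rewrite -mdist_gt0 => az.
have az2 : 0 < mdist (iota a) z / 2 by rewrite divr_gt0.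
have Fb : F (ball a (mdist (iota a) z / 2)) by apply: Fa; exact: nbhsx_ballx.
have [u /= [au uz]] := @filter_ex _ _ FF _ (filterI Fb (Fball _ az2)).
move: au; rewrite ballEmdist /= -iso => au.
have := metric_triangle (iota a) (iota u) z; lra.
Qed.

Lemma gromov_hyperbolic_hyperbolization : is_completion iota ->
  locally_complete X -> mboundary iota !=set0 ->
  gromov_hyperbolic (hyperbolization iota) (ln 4).
Proof.
move=> iotaP lcX incX; pose D x := ln (bdist iota x).
pose u x y := mdist x y + Num.max (bdist iota x) (bdist iota y).
have d0 x := bdist_gt0 x iotaP lcX incX.
have u0 x y : 0 < u x y.
  by rewrite ltr_wpDl ?mdist_ge0// lt_max d0.
have uC x y : u x y = u y x by rewrite /u metric_sym maxC.
have uT x y z : u x z <= u x y + u y z.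
  have := metric_triangle x y z; have := d0 x; have := d0 y; have := d0 z.
  rewrite /u /Num.max; repeat case: ifP => ?; lra.
have hE x y : hyperbolization iota x y = 2 * ln (u x y) - D x - D y.
  have s0 : 0 < Num.sqrt (bdist iota x * bdist iota y).
    by rewrite sqrtr_gt0 mulr_gt0.
  have : ln (Num.sqrt (bdist iota x * bdist iota y)) *+ 2 = D x + D y.
    by rewrite -lnXn// sqr_sqrtr ?lnM ?posrE// mulr_ge0// ltW.
  rewrite /hyperbolization -/(u x y) ln_div ?posrE//; lra.
have ln4 : ln 4 = 2 * ln 2 :> R.
  have -> : 4 = 2 ^+ 2 :> R by rewrite -natrX.
  by rewrite lnXn// mulr_natl.
have step x y z : u x z <= u y z -> ln (u x y) <= ln 2 + ln (u y z).
  move=> le; rewrite -lnM ?posrE// ler_ln ?posrE ?mulr_gt0//.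
  have := uT x z y; rewrite (uC z y); lra.
move=> x y z w; rewrite /gromov_prod !hE ln4 (uC z y).
have key a b c e : u a c <= u b c -> u a c <= u a e ->
    ln (u a b) + ln (u c e) <= 2 * ln 2 + ln (u a e) + ln (u b c).
  move=> le1 le2; have := step a b c le1.
  have := step c e a; rewrite (uC c a) (uC e a) => /(_ le2); lra.
have k1 := key x y z w; have k2 := key y x w z.
have k3 := key x y w z; have k4 := key y x z w.
rewrite ?(uC y x) ?(uC w z) in k1 k2 k3 k4.
have K : ln (u x y) + ln (u z w) <= 2 * ln 2 + ln (u x w) + ln (u y z) \/
         ln (u x y) + ln (u z w) <= 2 * ln 2 + ln (u x z) + ln (u y w).
  have [h1|/ltW h1] := leP (u x z) (u y w);
    have [h2|/ltW h2] := leP (u x w) (u y z).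
  - have [h3|/ltW h3] := leP (u x z) (u x w).
      by left; apply: k1 => //; exact: le_trans h2.
    by right; apply: k3 => //; exact: le_trans h1.
  - have [h3|/ltW h3] := leP (u x z) (u y z).
      by left; apply: k1 => //; exact: le_trans h2.
    by right; rewrite addrAC; apply: k4 => //; exact: le_trans h1.
  - have [h3|/ltW h3] := leP (u y w) (u x w).
      by left; rewrite addrAC; apply: k2 => //; exact: le_trans h2.
    by right; apply: k3 => //; exact: le_trans h1.
  - have [h3|/ltW h3] := leP (u y w) (u y z).
      by left; rewrite addrAC; apply: k2 => //; exact: le_trans h2.
    by right; rewrite addrAC; apply: k4 => //; exact: le_trans h1.
clear -K; rewrite lerBlDr ge_min; apply/orP.
by case: K => K; [right|left]; lra.
Qed.

End hyperbolization_theory.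

(* Main.v *)
(* With u(x, y) = d(x, y) + max(d(x), d(y)), the Gromov products of the
   hyperbolization are
     (x|y)_w = ln (u(x, w) u(y, w) / (u(x, y) d(w))).
   Hence a sequence is a Gromov sequence iff it converges to a point of the metric
   boundary or its distance to a fixed point tends to infinity, and equivalence
   means having the same limit: the Gromov boundary is the metric boundary
   together with one point xi at infinity. The Busemann functions based at xi
   are b(x) = ln d(w) - ln d(x), so that (x|y)_b = ln d(w) - ln u(x, y), and
   letting x and y tend to boundary points gives
     rho_{b, eps}(zeta1, zeta2) = (d(phi zeta1, phi zeta2) / d(w))^eps.
   Letting w tend to infinity in the four-point inequality for h shows that d is a
   quasi-ultrametric on the boundary; for admissible eps this makes rho_{b, eps}
   a quasi-ultrametric with constant at most sqrt 2, so by Frink's lemma the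
   Hamenstädt metric is at least rho_{b, eps} / 2. Thus phi is a snowflake map up
   to a factor 2, and quasisymmetric with eta(t) = (2 t)^(1 / eps). *)
Require Import Defs.
From HB Require Import structures.
From mathcomp Require Import all_boot all_order all_algebra.
From mathcomp Require Import all_classical all_reals all_analysis.
From mathcomp Require Import lra ring zify.
Set Implicit Arguments.
Unset Strict Implicit.
Unset Printing Implicit Defensive.
Import Order.TTheory GRing.Theory Num.Theory.
Import numFieldNormedType.Exports.
Local Open Scope classical_set_scope.
Local Open Scope ring_scope.

(** * Chains, homeomorphisms of the half-line and lower limits *)

Section generalities.
Context {R : realType}.

(** Monotone maps can only fail continuity by jumping, and surjectivity excludes jumps: preimages of
    [g x + e / 2] and [g x - e / 2] bracket [x]. *)
Lemma homeo_halfline_increasing (g : R -> R) :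
  (forall s, 0 <= s -> 0 <= g s) ->
  (forall s t, 0 <= s -> s < t -> g s < g t) ->
  (forall v, 0 <= v -> exists2 s, 0 <= s & g s = v) ->
  homeo_halfline g.
Proof.
move=> g0 gmono gsurj.
have I s : `[0, +oo[%classic s = (0 <= s) :> Prop.
  by rewrite /= in_itv /= andbT.
have gle s t : 0 <= t -> g s < g t -> 0 <= s -> s < t.
  move=> t0 + s0; apply: contraTT; rewrite -!leNgt le_eqVlt => /predU1P[->//|].
  by move=> /(gmono _ _ t0)/ltW.
split.
- split.
  + by move=> s; rewrite !I; exact: g0.
  + move=> s t /set_mem + /set_mem +; rewrite !I => s0 t0 gst.
    case: (ltgtP s t) => // st.
      by have := gmono _ _ s0 st; rewrite gst ltxx.
    by have := gmono _ _ t0 st; rewrite gst ltxx.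
  + by move=> v; rewrite I => /gsurj[s s0 <-]; exists s; rewrite ?I.
- move=> x; rewrite I => x0 e e0.
  have [x1 x10 gx1] : exists2 s, 0 <= s & g s = g x + e / 2.
    by apply: gsurj; have := g0 _ x0; lra.
  have xx1 : x < x1 by apply: gle => //; rewrite gx1; lra.
  have [l l0 hl] : exists2 l, 0 < l & forall y, 0 <= y -> x - y < l -> g x - g y < e.
    (* A negative target has no preimage in the half-line, but then [0 <= g y] already bounds
       [g x - g y] and any radius will do. *)
    have [gxe|gxe] := ltP (g x - e / 2) 0.
      by exists 1 => // y y0 _; have := g0 _ y0; lra.
    have [x2 x20 gx2] := gsurj _ gxe.
    have x2x : x2 < x by apply: gle => //; rewrite gx2; lra.
    exists (x - x2); first by rewrite subr_gt0.
    move=> y y0 xy; have : g x2 < g y by apply: gmono => //; lra.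
    lra.
  exists (Num.min (x1 - x) l); first by rewrite lt_min l0 subr_gt0 xx1.
  move=> y; rewrite I => y0; rewrite lt_min => /andP[].
  rewrite !ltr_distl => /andP[h1 _] /andP[h2 h3].
  have := hl _ y0; have : g y < g x1 by apply: gmono => //; lra.
  rewrite gx1; have : x - y < l by lra.
  move=> h4 h5 /(_ h4) h6; apply/andP; split; lra.
- move=> x; rewrite I => x0 e e0.
  have [l l0 hl] : exists2 l, 0 < l & forall y, 0 <= y -> g x - g y < l -> x - y < e.
    have [xe|xe] := ltP (x - e / 2) 0.
      by exists 1 => // y y0 _; lra.
    exists (g x - g (x - e / 2)); first by rewrite subr_gt0 gmono//; lra.
    move=> y y0 h; have : x - e / 2 < y by apply: gle => //; lra.
    lra.
  have gxe : g x < g (x + e / 2) by apply: gmono => //; lra.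
  exists (Num.min (g (x + e / 2) - g x) l); first by rewrite lt_min l0 subr_gt0 gxe.
  move=> y; rewrite I => y0; rewrite lt_min => /andP[].
  rewrite !ltr_distl => /andP[h1 _] /andP[h2 h3].
  have h4 := hl _ y0.
  have : y < x + e / 2 by apply: gle => //; lra.
  have : x - y < e by apply: h4; lra.
  move=> h5 h6; apply/andP; split; lra.
Qed.

Lemma homeo_halfline_powR (a p : R) : 0 < a -> 0 < p ->
  homeo_halfline (fun t => (a * t) `^ p).
Proof.
move=> a0 p0; apply: homeo_halfline_increasing.
- by move=> s _; exact: powR_ge0.
- move=> s t s0 st; apply: gt0_ltr_powR => //.
  + by rewrite nnegrE mulr_ge0// ltW.
  + by rewrite nnegrE mulr_ge0// ltW// (le_lt_trans s0).
  + by rewrite ltr_pM2l.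
- move=> v v0; exists (v `^ p^-1 / a); first by rewrite divr_ge0 ?powR_ge0// ltW.
  by rewrite mulrC divfK ?gt_eqF// -powRrM mulVf ?gt_eqF// powRr1.
Qed.

(* Frink's argument: cut the chain at the last index where the partial
   sum is at most half of the total. *)
Lemma chain_quasimetric (r : nat -> nat -> R) (K : R) (N : nat) :
  K * K <= 2 -> 0 <= K ->
  (forall i j, 0 <= r i j) -> (forall i, r i i = 0) ->
  (forall i j k, (i <= N)%N -> (j <= N)%N -> (k <= N)%N ->
     r i j <= K * Num.max (r i k) (r k j)) ->
  r 0%N N <= 2 * \sum_(i < N) r i i.+1.
Proof.
move=> K2 K0 r0 rxx rK.
suff H n a : (a + n <= N)%N -> r a (a + n)%N <= 2 * \sum_(a <= i < a + n) r i i.+1.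
  by have := H N 0%N (leqnn _); rewrite add0n big_mkord.
elim/ltn_ind: n a => n IH a anN.
case: n IH anN => [|n] IH anN.
  by rewrite addn0 rxx big_geq// mulr0.
have bnd p : (p <= n)%N -> [/\ (a <= N)%N, (a + p <= N)%N, ((a + p).+1 <= N)%N
    & ((a + p).+1 + (n - p) = a + n.+1)%N].
  by move=> pn; clear -pn anN; split; lia.
set S := \sum_(a <= i < a + n.+1) r i i.+1.
pose F p := \sum_(a <= i < a + p) r i i.+1.
have S0 : 0 <= S by apply: sumr_ge0.
pose P p := (p <= n)%N && (F p <= S / 2).
have exP : exists p, P p.
  by exists 0%N; rewrite /P /F addn0 big_geq//= divr_ge0.
have bP p : P p -> (p <= n)%N by case/andP.
case: (ex_maxnP exP bP) => p /andP[pn Fp] pmax.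
have [aN apN apN' e] := bnd p pn.
have SE : S = F p + r (a + p)%N (a + p).+1 + \sum_((a + p).+1 <= i < a + n.+1) r i i.+1.
  rewrite /S (@big_cat_nat _ _ _ (a + p)%N)//=; [|lia|lia].
  by rewrite (@big_ltn _ _ _ (a + p)%N) ?addrA//; lia.
have G0 : 0 <= \sum_((a + p).+1 <= i < a + n.+1) r i i.+1 by apply: sumr_ge0.
have F0 : 0 <= F p by apply: sumr_ge0.
(* Maximality of [p] makes the sum up to and including the link at [a + p] exceed [S / 2], so less
   than half remains; for [p = n] nothing remains. *)
have Gle : \sum_((a + p).+1 <= i < a + n.+1) r i i.+1 <= S / 2.
  have [pn'|pn'] := ltnP p n.
    have nP : ~~ P p.+1 by apply/negP => /pmax; rewrite ltnn.
    move: nP; rewrite /P pn' /= -ltNge /F addnS big_nat_recr/=; last lia.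
    rewrite -/(F p); lra.
  rewrite big_geq; first lra.
  lia.
have h1 : r a (a + p)%N <= S.
  by have := IH p pn a apN; rewrite -/(F p); lra.
have h2 : r (a + p)%N (a + p).+1 <= S by have := r0 (a + p)%N (a + p).+1; lra.
have h3 : r (a + p).+1 (a + n.+1)%N <= S.
  have := IH (n - p)%N (leq_subr _ _) (a + p).+1; rewrite e => /(_ anN); lra.
have h4 : r (a + p)%N (a + n.+1)%N <= K * S.
  apply: le_trans (rK _ _ _ apN anN apN') _.
  by rewrite ler_wpM2l// ge_max h2.
(* The three pieces, each at most [S], are joined by two uses of [rK]. The resulting constant is
   [K * K] if [1 <= K] and [K] otherwise, at most 2 in both cases. *)
have K1 : K * S <= Num.max 1 K * S by rewrite ler_wpM2r// le_max lexx orbT.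
have h5 : r a (a + n.+1)%N <= K * (Num.max 1 K * S).
  apply: le_trans (rK _ _ _ aN anN apN) _.
  rewrite ler_wpM2l// ge_max (le_trans h4)// andbT (le_trans h1)//.
  by rewrite ler_peMl// le_max lexx.
apply: le_trans h5 _; rewrite mulrA ler_wpM2r//.
by have [_|K1'] := leP 1 K; [exact: K2|clear -K1'; lra].
Qed.

Lemma lt_limn_einf_near (v : nat -> \bar R) (t : \bar R) :
  (t < limn_einf v)%E -> \forall n \near \oo, (t < v n)%E.
Proof.
rewrite limn_einf_lim (cvg_lim _ (ereal_nondecreasing_cvgn (nondecreasing_einfs v)))//.
move=> /ereal_sup_gt[_ [n _ <-] tn]; exists n => // m /= nm.
apply: lt_le_trans tn _; apply: ereal_inf_lbound.
by exists m.
Qed.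

Lemma limn_einf_EFin (v : nat -> R) (l : R) : v i @[i --> \oo] --> l ->
  limn_einf (fun i => (v i)%:E) = l%:E.
Proof.
move=> vl; suff H : (v i)%:E @[i --> \oo] --> l%:E by have [-> _] := cvg_limn_einf_sup H.
by apply: cvg_EFin vl; exact: nearW.
Qed.

(** Serves the infima over representing sequences: based at infinity, the lower limits turn out not
    to depend on the representatives. *)
Lemma ereal_inf_constant (A : set (\bar R)) (v : \bar R) :
  A !=set0 -> (forall s, A s -> s = v) -> ereal_inf A = v.
Proof.
move=> [s As] Av; rewrite -[RHS]ereal_inf1; congr ereal_inf.
by apply/seteqP; split => [t /Av//|t ->]; rewrite -(Av s).
Qed.

End generalities.

(** * Gromov sequences for the hyperbolization *)

Section gromov_boundary_of_hyperbolization.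
Context {R : realType} {X Y : metricType R} (iota : X -> Y).
Context (iotaP : is_completion iota) (lcX : locally_complete X)
  (incX : mboundary iota !=set0).

Local Notation D := (bdist iota).
Local Notation h := (hyperbolization iota).

Definition hsize (x y : X) : R := mdist x y + Num.max (D x) (D y).

Local Notation u := hsize.

Lemma mdist_completion x y : mdist (iota x) (iota y) = mdist x y.
Proof. by have [_ -> _] := iotaP. Qed.

Lemma bdist_pos x : 0 < D x. Proof. exact: bdist_gt0. Qed.

Lemma bdist_le_mdist x z : mboundary iota z -> D x <= mdist (iota x) z.
Proof.
move=> zb; apply: ge_inf; last by exists z.
by exists 0 => _ [z' _ <-]; exact: mdist_ge0.
Qed.

Lemma bdist_lipschitz x y : D x <= mdist x y + D y.
Proof.
rewrite -lerBlDl; apply: lb_le_inf.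
  by have [z zb] := incX; exists (mdist (iota y) z), z.
move=> _ [z zb <-]; rewrite lerBlDl (le_trans (bdist_le_mdist x zb))//.
by rewrite -mdist_completion metric_triangle.
Qed.

Lemma hsizeC x y : u x y = u y x.
Proof. by rewrite /hsize metric_sym maxC. Qed.

Lemma mdist_le_hsize x y : mdist x y <= u x y.
Proof. by rewrite lerDl le_max ltW// bdist_pos. Qed.

Lemma bdist_le_hsizel x y : D x <= u x y.
Proof. by rewrite ler_wpDl ?mdist_ge0// le_max lexx. Qed.

Lemma bdist_le_hsizer x y : D y <= u x y.
Proof. by rewrite hsizeC bdist_le_hsizel. Qed.

Lemma hsize_gt0 x y : 0 < u x y.
Proof. exact: lt_le_trans (bdist_pos x) (bdist_le_hsizel x y). Qed.

Lemma hsize_le x y : u x y <= 2 * mdist x y + D y.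
Proof.
have := bdist_lipschitz x y; have := mdist_ge0 x y.
rewrite /hsize /Num.max; case: ifP => _; lra.
Qed.

Lemma hsize_triangle x y z : u x z <= u x y + u y z.
Proof.
have := metric_triangle x y z; have := bdist_pos x; have := bdist_pos y.
have := bdist_pos z; rewrite /hsize /Num.max; repeat case: ifP => ?; lra.
Qed.

(** Both [mdist] and [D] are 1-Lipschitz. The error does not involve [z], so it becomes negligible
    against [u y z] when [z] goes to infinity. *)
Lemma hsize_mdist x y z : u x z <= 2 * mdist x y + u y z.
Proof.
have := metric_triangle x y z; have := bdist_lipschitz x y.
have := mdist_ge0 x y.
by rewrite /hsize /Num.max; repeat case: ifP => ?; lra.
Qed.

Lemma hyperbolizationE x y : h x y = 2 * ln (u x y) - ln (D x) - ln (D y).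
Proof.
have [x0 y0] := (bdist_pos x, bdist_pos y).
have s0 : 0 < Num.sqrt (D x * D y) by rewrite sqrtr_gt0 mulr_gt0.
have : ln (Num.sqrt (D x * D y)) *+ 2 = ln (D x) + ln (D y).
  by rewrite -lnXn// sqr_sqrtr ?lnM ?posrE// mulr_ge0// ltW.
by rewrite /hyperbolization -/(u x y) ln_div ?posrE ?hsize_gt0//; lra.
Qed.

Lemma gromov_prod_hyperbolization w x y :
  gromov_prod h w x y = ln (u x w * u y w / (u x y * D w)).
Proof.
rewrite ln_div ?posrE ?mulr_gt0 ?hsize_gt0 ?bdist_pos//.
rewrite !lnM ?posrE ?hsize_gt0 ?bdist_pos//.
by rewrite /gromov_prod !hyperbolizationE; lra.
Qed.

Lemma gromov_prod_gt w x y t : (t < gromov_prod h w x y) =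
  (expR t * (u x y * D w) < u x w * u y w).
Proof.
have uxy := hsize_gt0 x y; have w0 := bdist_pos w.
have q0 : 0 < u x w * u y w / (u x y * D w).
  by rewrite divr_gt0 ?mulr_gt0 ?hsize_gt0.
rewrite gromov_prod_hyperbolization -[in LHS](expRK t).
rewrite ltr_ln ?posrE ?expR_gt0// ltr_pdivlMr//.
by rewrite mulr_gt0.
Qed.

(** The triangle inequality gives [u y w <= 2 * u x y], so the far point cancels from the quotient.
    This bound is what separates infinity from bounded sequences. *)
Lemma gromov_prod_far w x y M : u x w <= M -> 2 * M <= u y w ->
  gromov_prod h w x y <= ln (2 * M / D w).
Proof.
move=> xM yM; have M0 : 0 < M := lt_le_trans (hsize_gt0 _ _) xM.
have w0 := bdist_pos w.
rewrite leNgt gromov_prod_gt lnK ?posrE ?divr_gt0 ?mulr_gt0// -leNgt.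
rewrite mulrCA divfK ?gt_eqF//.
have := hsize_triangle y x w; rewrite (hsizeC y x) => tri.
apply: (@le_trans _ _ (M * u y w)).
  by rewrite ler_pM2r ?hsize_gt0.
by rewrite [leRHS]mulrC -mulrA mulrCA ler_pM2l//; lra.
Qed.

(* None is the point at infinity. *)
Definition tends (x : nat -> X) (p : option Y) : Prop :=
  match p with
  | Some a => iota (x i) @[i --> \oo] --> a
  | None => forall w, mdist (x i) w @[i --> \oo] --> +oo
  end.

Definition ideal_point (p : option Y) : Prop :=
  p = None \/ (Some @` mboundary iota) p.

Lemma ideal_point_Some a : ideal_point (Some a) -> mboundary iota a.
Proof. by case=> // -[b b0 [<-]]. Qed.

Lemma tends_Some_near x a e : tends x (Some a) -> 0 < e ->
  \forall i \near \oo, mdist (iota (x i)) a < e.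
Proof.
move=> /metricType_numDomainType.cvgrPdist_lt xa /xa; apply: filterS => i.
by rewrite metric_sym.
Qed.

Lemma tends_None_near x w M : tends x None -> \forall i \near \oo, M < u (x i) w.
Proof.
move=> /(_ w)/cvgryPgt/(_ M); apply: filterS => i /lt_le_trans; apply.
exact: mdist_le_hsize.
Qed.

Lemma tends_None w x :
  (forall M, \forall i \near \oo, M < u (x i) w) -> tends x None.
Proof.
move=> H w'; apply/cvgryPgt => M.
apply: filterS (H (2 * (M + mdist w' w) + D w)) => i.
have := hsize_le (x i) w; have := metric_triangle (x i) w' w.
lra.
Qed.

(** At a boundary point, [u (x i) (y j)] tends to 0 while the factors [u (x i) w] and [u (y j) w]
    stay above [D w]. At infinity, [u (x i) (y j)] is at most the sum of these two factors, and
    their product outgrows their sum. *)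
Lemma gromov_prod_tends w x y p : ideal_point p -> tends x p -> tends y p ->
  gromov_prod h w (x ij.1) (y ij.2) @[ij --> (\oo, \oo)] --> +oo.
Proof.
move=> idp xp yp; apply/cvgryPgt => A.
have w0 := bdist_pos w; have A0 := expR_gt0 A.
case: p idp xp yp => [a|] idp xp yp.
  have {idp} ab := ideal_point_Some idp.
  have e0 : 0 < D w / (4 * expR A) by rewrite divr_gt0// mulr_gt0.
  exists ([set i | mdist (iota (x i)) a < D w / (4 * expR A)],
          [set i | mdist (iota (y i)) a < D w / (4 * expR A)]) => /=.
    by split; exact: tends_Some_near.
  move=> [i j] /= [xi yj]; rewrite gromov_prod_gt.
  have : u (x i) (y j) < D w / expR A.
    have -> : D w / expR A = 4 * (D w / (4 * expR A)).
      by field; rewrite gt_eqF.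
    have := bdist_le_mdist (x i) ab; have := bdist_le_mdist (y j) ab.
    have := metric_triangle (iota (x i)) a (iota (y j)).
    have := mdist_ge0 (iota (x i)) a; have := mdist_ge0 (iota (y j)) a.
    rewrite (metric_sym a) mdist_completion /hsize /Num.max.
    case: ifP => _; lra.
  rewrite ltr_pdivlMr// => lt1; rewrite mulrA mulrC.
  apply: (@lt_le_trans _ _ (D w * D w)).
    by rewrite ltr_pM2l// mulrC.
  by rewrite ler_pM ?(ltW w0)// bdist_le_hsizer.
exists ([set i | 2 * expR A * D w < u (x i) w],
        [set i | 2 * expR A * D w < u (y i) w]) => /=.
  by split; exact: tends_None_near.
move=> [i j] /= [xi yj]; rewrite gromov_prod_gt.
have := hsize_triangle (x i) w (y j); rewrite (hsizeC w).
set p := u (x i) w in xi *; set q := u (y j) w in yj *.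
move=> upq; have p0 : 0 < p := hsize_gt0 _ _; have q0 : 0 < q := hsize_gt0 _ _.
have k1 : 2 * expR A * D w * q < p * q by rewrite ltr_pM2r.
have k2 : 2 * expR A * D w * p < p * q by rewrite [p * q]mulrC ltr_pM2r.
have k3 : expR A * D w * u (x i) (y j) <= expR A * D w * (p + q).
  by rewrite ler_pM2l// mulr_gt0.
lra.
Qed.

Lemma tends_gromov_seq x p : ideal_point p -> tends x p -> gromov_seq h x.
Proof. by move=> idp xp w; have := gromov_prod_tends w idp xp xp. Qed.

Lemma tends_gromov_equiv x y p : ideal_point p -> tends x p -> tends y p ->
  gromov_equiv h x y.
Proof.
move=> idp xp yp w; have := gromov_prod_tends w idp xp yp => H.
by apply: (cvg_comp (fun i => (i, i)) _ _ H); exact: cvg_pair.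
Qed.

(** Small [u] means both that the sequence is Cauchy and that [D] tends to 0 along it. A limit
    [iota z] would then have [D z = 0] by the Lipschitz bound, contradicting [bdist_pos]. *)
Lemma tends_cauchy_mboundary x : (forall e, 0 < e -> exists N,
    forall i j, (N <= i)%N -> (N <= j)%N -> u (x i) (x j) < e) ->
  exists2 a, mboundary iota a & tends x (Some a).
Proof.
move=> ux; have [cY _ _] := iotaP.
have ux' e : 0 < e -> exists N, forall i j, (N <= i)%N -> (N <= j)%N ->
    mdist (x i) (x j) < e /\ D (x j) < e.
  move=> /ux[N HN]; exists N => i j Ni Nj; split.
    exact: le_lt_trans (mdist_le_hsize _ _) (HN _ _ Ni Nj).
  exact: le_lt_trans (bdist_le_hsizer _ _) (HN _ _ Ni Nj).
have [||a _ xa] := cY (iota (x i) @[i --> \oo]) _.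
- apply: cauchy_exP => e e0.
  have [N HN] := ux' _ e0; exists (iota (x N)); exists N => // j /= Nj.
  by rewrite ballEmdist /= mdist_completion; have [] := HN N j (leqnn _) Nj.
- exact: filterT.
exists a => //= -[z _ za].
have z0 : 0 < D z / 2 by rewrite divr_gt0// bdist_pos.
have [N HN] := ux' _ z0.
move/metricType_numDomainType.cvgrPdist_lt : (xa) => /(_ _ z0)[M _ HM].
have := HM (maxn M N) (leq_maxl _ _); rewrite /= -za mdist_completion.
have [_] := HN (maxn M N) (maxn M N) (leq_maxr _ _) (leq_maxr _ _).
have := bdist_lipschitz z (x (maxn M N)).
lra.
Qed.

(** If the sequence does not escape, it returns to some ball infinitely often; by [gromov_prod_far]
    large products then keep its whole tail bounded, and for bounded terms a large product forces
    [u (x i) (x j)] to be small. *)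
Lemma gromov_seq_tends x : gromov_seq h x -> exists2 p, ideal_point p & tends x p.
Proof.
have [w _] : exists w : X, True.
  have [_ _ dns] := iotaP; have [z _] := incX.
  by have [|y [_ [w _ _]]] := dns setT _ openT; [exists z | exists w].
move=> /(_ w)/cvgryPgt gx.
have gxN A : exists N, forall i j, (N <= i)%N -> (N <= j)%N ->
    expR A * (u (x i) (x j) * D w) < u (x i) w * u (x j) w.
  have [[P Q] /= [[N1 _ P1] [N2 _ Q2]] PQ] := gx A.
  exists (maxn N1 N2) => i j; rewrite !geq_max => /andP[i1 i2] /andP[j1 j2].
  by rewrite -gromov_prod_gt; apply: (PQ (i, j)); split; [exact: P1|exact: Q2].
have w0 := bdist_pos w.
have [H|] := pselect (forall M, \forall i \near \oo, M < u (x i) w).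
  by exists None; [left | exact: tends_None H].
move=> /existsNP[M nM].
have ub : exists N, forall j, (N <= j)%N -> u (x j) w <= 2 * M.
  have [N HN] := gxN (ln (2 * M / D w)); exists N => j Nj.
  have [i Ni uiM] : exists2 i, (N <= i)%N & u (x i) w <= M.
    apply: contrapT => nex; apply: nM; exists N => // i /= Ni.
    by rewrite ltNge; apply/negP => uiM; apply: nex; exists i.
  have M0 : 0 < M := lt_le_trans (hsize_gt0 _ _) uiM.
  rewrite leNgt; apply/negP => ujM.
  have := HN i j Ni Nj.
  by rewrite -gromov_prod_gt ltNge gromov_prod_far// ltW.
have [N HN] := ub.
have [|a ab xa] := @tends_cauchy_mboundary x; last first.
  by exists (Some a) => //; right; exists a.
(* With both factors at most [2 * M], a product above this [A] yields exactly
   [u (x i) (x j) < e]. *)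
move=> e e0; pose A := ln (4 * M ^+ 2 / (e * D w)).
have M0 : 0 < M by have := HN N (leqnn _); have := hsize_gt0 (x N) w; lra.
have [N' HN'] := gxN A; exists (maxn N N') => i j.
rewrite !geq_max => /andP[iN iN'] /andP[jN jN'].
have := HN' i j iN' jN'; rewrite /A lnK; last first.
  by rewrite posrE divr_gt0 ?mulr_gt0// exprn_gt0.
have -> : 4 * M ^+ 2 / (e * D w) * (u (x i) (x j) * D w) =
  (4 * M ^+ 2) * (u (x i) (x j) / e) by field; rewrite !gt_eqF.
move=> h1; have h2 : u (x i) w * u (x j) w <= 2 * M * (2 * M).
  by rewrite ler_pM ?(ltW (hsize_gt0 _ _)) ?HN.
have : 4 * M ^+ 2 * (u (x i) (x j) / e) < 4 * M ^+ 2 * 1.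
  apply: lt_le_trans h1 _; apply: le_trans h2 _; rewrite expr2; lra.
by rewrite ltr_pM2l ?mulr_gt0 ?exprn_gt0// ltr_pdivrMr// mul1r.
Qed.

(** A finite limit paired with infinity contradicts [gromov_prod_far]. For two finite limits both
    sequences are bounded, so the product can only blow up through [u (x i) (y i)] tending to 0. *)
Lemma tends_uniq w x y p q : tends x p -> tends y q ->
  ideal_point p -> ideal_point q ->
  gromov_prod h w (x i) (y i) @[i --> \oo] --> +oo -> p = q.
Proof.
have w0 := bdist_pos w.
have H x' y' a : tends x' (Some a) -> tends y' None ->
    gromov_prod h w (x' i) (y' i) @[i --> \oo] --> +oo -> False.
  move=> xa ya /cvgryPgt gxy.
  pose M := 2 * (mdist a (iota w) + 1) + D w.
  have M0 : 0 < M by rewrite /M; have := mdist_ge0 a (iota w); lra.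
  have : \forall i \near \oo, False; last by move=> /filter_ex[].
  near=> i.
  have uxM : u (x' i) w < M.
    have : mdist (iota (x' i)) a < 1 by near: i; apply: tends_Some_near.
    have := metric_triangle (iota (x' i)) a (iota w).
    rewrite mdist_completion; have := hsize_le (x' i) w; rewrite /M; lra.
  have uyM : 2 * M < u (y' i) w by near: i; exact: tends_None_near.
  have : ln (2 * M / D w) < gromov_prod h w (x' i) (y' i) by near: i.
  by rewrite ltNge gromov_prod_far// ltW.
case: p q => [a|] [b|] xp yq idp idq gxy //.
- congr Some; apply: mdist_positivity; apply/eqP; rewrite eq_le mdist_ge0 andbT.
  apply/ler_addgt0Pl => e e0; rewrite addr0.
  pose M := 2 * (mdist a (iota w) + mdist b (iota w) + 1) + D w.
  have M0 : 0 < M.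
    by rewrite /M; have := mdist_ge0 a (iota w); have := mdist_ge0 b (iota w); lra.
  have e30 : 0 < e / 3 by rewrite divr_gt0.
  move/cvgryPgt : gxy => gxy.
  have : \forall i \near \oo, mdist a b <= e; last by move=> /filter_ex[].
  near=> i.
  have xa1 : mdist (iota (x i)) a < 1 by near: i; apply: tends_Some_near.
  have ya1 : mdist (iota (y i)) b < 1 by near: i; apply: tends_Some_near.
  have xa : mdist (iota (x i)) a < e / 3 by near: i; apply: tends_Some_near.
  have yb : mdist (iota (y i)) b < e / 3 by near: i; apply: tends_Some_near.
  have uxM : u (x i) w <= M.
    have := metric_triangle (iota (x i)) a (iota w); have := mdist_ge0 b (iota w).
    rewrite mdist_completion; have := hsize_le (x i) w; rewrite /M; lra.
  have uyM : u (y i) w <= M.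
    have := metric_triangle (iota (y i)) b (iota w); have := mdist_ge0 a (iota w).
    rewrite mdist_completion; have := hsize_le (y i) w; rewrite /M; lra.
  (* This threshold gives [u (x i) (y i) < e / 3]; the other two thirds of [e] pay for the distances
     to [a] and [b]. *)
  have : ln (M ^+ 2 / (e / 3 * D w)) < gromov_prod h w (x i) (y i) by near: i.
  rewrite gromov_prod_gt lnK; last first.
    by rewrite posrE divr_gt0 ?mulr_gt0// exprn_gt0.
  have -> : M ^+ 2 / (e / 3 * D w) * (u (x i) (y i) * D w) =
    M ^+ 2 * (u (x i) (y i) / (e / 3)) by field; rewrite !gt_eqF.
  move=> h1; have h2 : u (x i) w * u (y i) w <= M * M.
    by rewrite ler_pM ?(ltW (hsize_gt0 _ _)).
  have : M ^+ 2 * (u (x i) (y i) / (e / 3)) < M ^+ 2 * 1.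
    by apply: lt_le_trans h1 _; apply: le_trans h2 _; rewrite expr2 mulr1.
  rewrite ltr_pM2l ?exprn_gt0// ltr_pdivrMr// mul1r => ue.
  have := mdist_le_hsize (x i) (y i); rewrite -mdist_completion.
  have := metric_triangle a (iota (x i)) b; rewrite (metric_sym a (iota _)).
  have := metric_triangle (iota (x i)) (iota (y i)) b.
  lra.
- by have := H _ _ _ xp yq gxy.
- case: (H _ _ _ yq xp); apply: cvg_trans gxy; apply: near_eq_cvg.
  apply: nearW => i; rewrite !gromov_prod_hyperbolization.
  by rewrite (hsizeC (x i) (y i)) (mulrC (u (x i) w)).
Unshelve. all: by end_near.
Qed.

(** * The Gromov boundary as the metric boundary with a point at infinity *)

Lemma completion_domain_nonempty : [set: X] !=set0.
Proof.
have [_ _ dns] := iotaP; have [z _] := incX.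
by have [|y [_ [w _ _]]] := dns setT _ openT; [exists z | exists w].
Qed.

Lemma tends_inj x p q : ideal_point p -> ideal_point q ->
  tends x p -> tends x q -> p = q.
Proof.
move=> idp idq xp xq; have [w _] := completion_domain_nonempty.
by apply: (tends_uniq xp xq idp idq (w := w)); exact: (tends_gromov_equiv idp).
Qed.

(** Convergence to an ideal point and Gromov equivalence determine each other, so from here on a
    class is handled only through the common limit of its sequences. *)
Lemma class_of_tends (z : gboundary h) :
  exists p, ideal_point p /\ class_of z = [set x | tends x p].
Proof.
case: z => C [x gx CE]; have [p idp xp] := gromov_seq_tends gx.
exists p; split => //; rewrite /class_of /= CE; apply/seteqP; split => y /=.
  move=> [/gromov_seq_tends[q idq yq]] xy.
  have [w _] := completion_domain_nonempty.
  by rewrite (tends_uniq xp yq idp idq (xy w)).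
move=> yp; split; first exact: tends_gromov_seq yp.
exact: (tends_gromov_equiv idp).
Qed.

(** Density of [X] in the completion reaches the boundary points, and unboundedness reaches
    infinity. *)
Lemma tends_exists (unb : ~ bounded_mset [set: X]) p : ideal_point p ->
  exists x, tends x p.
Proof.
have [w _] := completion_domain_nonempty.
case: p => [a|] idp.
  have [_ _ dns] := iotaP.
  have /choice[x xa] n : exists x, mdist a (iota x) < n.+1%:R^-1.
    have n0 : 0 < n.+1%:R^-1 :> R by rewrite invr_gt0.
    have [|y [ay [x _ xy]]] := dns (ball a n.+1%:R^-1)° _ (open_interior _).
      by exists a; exact: nbhsx_ballx.
    by exists x; have := interior_subset ay; rewrite -xy ballEmdist.
  exists x; apply/metricType_numDomainType.cvgrPdist_lt => e e0.
  near=> n; apply: lt_trans (xa n) _.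
  by near: n; exact: near_infty_natSinv_lt (PosNum e0).
have /choice[x xw] (n : nat) : exists x, n%:R < mdist x w.
  apply: contrapT => nex; apply: unb; exists (n%:R + n%:R) => x y _ _.
  have H v : mdist v w <= n%:R by rewrite leNgt; apply/negP => ?; apply: nex; exists v.
  have := metric_triangle x w y; rewrite (metric_sym w).
  have := H x; have := H y; lra.
exists x; apply: (@tends_None w) => M.
near=> n; apply: lt_le_trans (mdist_le_hsize _ _).
apply: lt_trans (xw n).
near: n; exact: nbhs_infty_gtr.
Unshelve. all: by end_near. Qed.

Section boundary_map.
Context (phi : gboundary h -> option Y).
Context (phi_ideal : forall z, ideal_point (phi z))
  (class_ofE : forall z, class_of z = [set x | tends x (phi z)]).

Lemma boundary_map_inj : injective phi.
Proof.
move=> z1 z2 e; have := class_ofE z1; rewrite e -class_ofE.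
case: z1 z2 {e} => C1 h1 [C2 h2] /= e; exact: eq_exist.
Qed.

Lemma boundary_map_surj (unb : ~ bounded_mset [set: X]) p : ideal_point p ->
  exists z, phi z = p.
Proof.
move=> idp; have [x xp] := tends_exists unb idp.
have gx := tends_gromov_seq idp xp.
exists (exist _ (gromov_class h x) (ex_intro2 _ _ x gx erefl)).
set z := exist _ _ _.
apply: (@tends_inj x) => //.
have -> : tends x (phi z) = [set x | tends x (phi z)] x by [].
by rewrite -class_ofE /=; split => //; exact: (tends_gromov_equiv idp).
Qed.

(** * Naturality of the boundary map *)

Lemma mdist_lt_hyperbolization x e : 0 < e ->
  exists2 r, 0 < r & forall y, h x y < r -> mdist x y < e.
Proof.
move=> e0; have x0 := bdist_pos x.
(* From [h x y < ln (1 + q)] follows [2 * mdist x y < q * M] with [M <= D x + mdist x y]. The bound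
   [q * D x <= e] controls the first term and [q <= 1] absorbs the second. *)
pose q := Num.min 1 (e / D x).
have q0 : 0 < q by rewrite lt_min ltr01 divr_gt0.
have q1 : q <= 1 by rewrite ge_min lexx.
have qe : q * D x <= e by rewrite -ler_pdivlMr// ge_min lexx orbT.
exists (ln (1 + q)); first by rewrite ln_gt0// ltrDl.
move=> y hr; have y0 := bdist_pos y.
have : ln (u x y ^+ 2) < ln ((1 + q) * (D x * D y)).
  rewrite lnXn ?hsize_gt0// !lnM ?posrE ?mulr_gt0// ?addr_gt0//.
  by move: hr; rewrite hyperbolizationE mulr_natl -mulr_natl; lra.
rewrite ltr_ln ?posrE ?exprn_gt0 ?hsize_gt0 ?mulr_gt0 ?addr_gt0//.
set M := Num.max (D x) (D y); rewrite /hsize -/M => lt1.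
have Mx : D x <= M by rewrite le_max lexx.
have My : D y <= M by rewrite le_max lexx orbT.
have M0 : 0 < M := lt_le_trans x0 Mx.
have Md : M <= D x + mdist x y.
  rewrite ge_max lerDl mdist_ge0/=.
  by have := bdist_lipschitz y x; rewrite (metric_sym y); lra.
have d0 := mdist_ge0 x y.
have lt2 : (mdist x y + M) ^+ 2 < (1 + q) * M ^+ 2.
  apply: lt_le_trans lt1 _; rewrite ler_pM2l ?addr_gt0//.
  by rewrite expr2 ler_pM// ltW.
have lt3 : 2 * mdist x y < q * M.
  rewrite -(ltr_pM2r M0).
  have := sqr_ge0 (mdist x y); move: lt2; rewrite !expr2; lra.
have : q * M <= q * (D x + mdist x y) by rewrite ler_pM2l.
have : q * mdist x y <= mdist x y by rewrite ler_piMl.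
lra.
Qed.

(** Leaving [q] arbitrary lets a single [t] serve points of [X], seen as constant sequences, and
    points of the Gromov boundary alike. *)
Lemma gromov_prod_near_mboundary w a e : mboundary iota a -> 0 < e ->
  exists2 t, 0 < t & forall x y q, tends x q -> tends y (Some a) ->
    (\forall i \near \oo, t < gromov_prod h w (x i) (y i)) ->
    exists2 b, q = Some b & mdist b a < e.
Proof.
move=> ab e0; have w0 := bdist_pos w.
pose M := 2 * (mdist a (iota w) + 1) + D w.
have M0 : 0 < M by have := mdist_ge0 a (iota w); rewrite /M; lra.
have e20 : 0 < e / 2 by rewrite divr_gt0.
have e40 : 0 < e / 4 by rewrite divr_gt0.
have k0 : 0 < M ^+ 2 / (e / 4) by rewrite divr_gt0 ?exprn_gt0.
(* Only [y] is known to be bounded, so [u (x i) w] is estimated by [U + M] where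
   [U = u (x i) (y i)]. The summand [M] cancels the resulting [U * M], and the other summand leaves
   [U < e / 4]. *)
pose t := ln ((M + M ^+ 2 / (e / 4)) / D w).
exists t.
  rewrite ln_gt0// ltr_pdivlMr// mul1r.
  have := mdist_ge0 a (iota w); rewrite /M in k0 *; lra.
move=> x y q xq ya tlt.
have xa : \forall i \near \oo, mdist (iota (x i)) a < e / 2.
  near=> i.
  have ya1 : mdist (iota (y i)) a < 1 by near: i; apply: tends_Some_near.
  have yae : mdist (iota (y i)) a < e / 4 by near: i; apply: tends_Some_near.
  have uyM : u (y i) w <= M.
    have := metric_triangle (iota (y i)) a (iota w).
    rewrite mdist_completion; have := hsize_le (y i) w; rewrite /M; lra.
  have : t < gromov_prod h w (x i) (y i) by near: i.
  rewrite gromov_prod_gt lnK; last by rewrite posrE divr_gt0// addr_gt0.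
  rewrite mulrCA divfK ?gt_eqF//.
  have := hsize_triangle (x i) (y i) w.
  set U := u (x i) (y i) => tri lt1.
  have U0 : 0 < U := hsize_gt0 _ _.
  have le2 : u (x i) w * u (y i) w <= (U + M) * M.
    by rewrite ler_pM ?(ltW (hsize_gt0 _ _))//; lra.
  have : M ^+ 2 * (U / (e / 4)) < M ^+ 2 * 1.
    have -> : M ^+ 2 * (U / (e / 4)) = U * (M ^+ 2 / (e / 4)).
      by field; rewrite gt_eqF.
    move: le2 lt1; rewrite !expr2; lra.
  rewrite ltr_pM2l ?exprn_gt0// ltr_pdivrMr// mul1r => Ue.
  have := mdist_le_hsize (x i) (y i); rewrite -mdist_completion -/U.
  have := metric_triangle (iota (x i)) (iota (y i)) a.
  lra.
case: q xq => [b|] xq.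
  exists b; first by [].
  have : \forall i \near \oo, mdist b a < e; last by move=> /filter_ex[].
  near=> i.
  have : mdist (iota (x i)) a < e / 2 by near: i.
  have : mdist (iota (x i)) b < e / 2 by near: i; exact: tends_Some_near.
  have := metric_triangle b (iota (x i)) a; rewrite (metric_sym b (iota _)).
  lra.
have /cvgryPgt xN := xq w.
have : \forall i \near \oo, False; last by move=> /filter_ex[].
near=> i.
have : mdist (iota (x i)) a < e / 2 by near: i.
have : mdist a (iota w) + e / 2 < mdist (x i) w.
  by near: i; exact: xN.
have := metric_triangle (iota (x i)) a (iota w); rewrite mdist_completion.
lra.
Unshelve. all: by end_near. Qed.

Lemma gromov_prod_near_infty w M : exists2 t, 0 < t & forall x y b,
    tends x (Some b) -> tends y None ->
    (\forall i \near \oo, t < gromov_prod h w (x i) (y i)) ->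
    M < mdist b (iota w).
Proof.
have w0 := bdist_pos w.
(* The absolute value covers negative [M]; it ensures [D w < N], hence a positive threshold. *)
pose N := 2 * (`|M| + 1) + D w.
have N0 : D w < N by rewrite /N; have := normr_ge0 M; lra.
exists (ln (2 * N / D w)).
  by rewrite ln_gt0// ltr_pdivlMr// mul1r; lra.
move=> x y b xb yN tlt; rewrite ltNge; apply/negP => bM.
have : \forall i \near \oo, False; last by move=> /filter_ex[].
near=> i.
have xb1 : mdist (iota (x i)) b < 1 by near: i; exact: tends_Some_near.
have : ln (2 * N / D w) < gromov_prod h w (x i) (y i) by near: i.
rewrite ltNge gromov_prod_far//.
  have := metric_triangle (iota (x i)) b (iota w); rewrite mdist_completion.
  by have := hsize_le (x i) w; rewrite /N; have := ler_norm M; lra.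
by apply: ltW; near: i; exact: tends_None_near.
Unshelve. all: by end_near. Qed.

Definition extended_embedding (p : X + gboundary h) : option Y :=
  match p with inl x => Some (iota x) | inr zeta => phi zeta end.

Lemma class_of_exists (z : gboundary h) : exists y, class_of z y.
Proof.
case: z => C [x gx CE]; exists x; rewrite /class_of /= CE.
have [p idp xp] := gromov_seq_tends gx.
by split => //; exact: (tends_gromov_equiv idp).
Qed.

(** Points of [X] become constant sequences. A strict lower bound on an infimum of lower limits
    holds for any chosen representatives, and eventually for their terms. *)
Lemma gromov_prod_ub_near w p zeta t :
  (t%:E < gromov_prod_ub w p zeta)%E -> exists x y,
  [/\ tends x (extended_embedding p), tends y (phi zeta)
    & \forall i \near \oo, t < gromov_prod h w (x i) (y i)].
Proof.
have [y yz] := class_of_exists zeta.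
have yp : tends y (phi zeta) by move: yz; rewrite class_ofE.
case: p => [x|z'] /= tlt.
  exists (cst x), y; split => //; first last.
    suff /lt_limn_einf_near :
        (t%:E < limn_einf (fun i => (gromov_prod h w x (y i))%:E))%E.
      by apply: filterS => i; rewrite lte_fin.
    by apply: lt_le_trans tlt _; apply: ereal_inf_lbound; exists y.
  apply/metricType_numDomainType.cvgrPdist_lt => e e0.
  by apply: nearW => i; rewrite mdistxx.
have [x xz] := class_of_exists z'.
exists x, y; split => //; first by move: xz; rewrite class_ofE.
suff /lt_limn_einf_near :
    (t%:E < limn_einf (fun i => (gromov_prod h w (x i) (y i))%:E))%E.
  by apply: filterS => i; rewrite lte_fin.
by apply: lt_le_trans tlt _; apply: ereal_inf_lbound; exists x => //; exists y.
Qed.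

Lemma ext_open_Some (U : set (option Y)) a : ext_open U -> U (Some a) ->
  exists2 e, 0 < e & forall b, mdist b a < e -> U (Some b).
Proof.
move=> oU Ua.
have {oU} : nbhs a (Some @^-1` U).
  case: oU => [[V oV UE]|[_ [C [cC _ UE]]]].
    move: Ua; rewrite UE => -[a' Va [<-]].
    by apply: filterS (open_nbhs_nbhs (conj oV Va)) => b Vb; exists b.
  have oC : open (~` C) by rewrite openC.
  have nCa : (~` C) a by move=> Ca; have : (~` U) (Some a); [rewrite UE; exists a|].
  apply: filterS (open_nbhs_nbhs (conj oC nCa)) => b nCb /=.
  apply: contrapT => nU; have : (~` U) (Some b) by [].
  by rewrite UE => -[b' Cb [bb]]; apply: nCb; rewrite -bb.
move=> /nbhs_ballP[e /= e0 eU]; exists e => // b ba.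
by apply: eU; rewrite ballEmdist /= metric_sym.
Qed.

Lemma ext_open_None (U : set (option Y)) a : ext_open U -> U None ->
  exists M, forall b, M < mdist b a -> U (Some b).
Proof.
move=> [[V _ ->] [? _ //]|[_ [C [_ [M MC] UE]]] _].
(* A diameter bound turns into a bound on the distance from [a] only through some point of [C]; if
   [C] is empty, any [M] works. *)
have [[c Cc]|C0] := pselect (exists c, C c).
  exists (mdist c a + M) => b; rewrite ltNge => /negP Mb; apply: contrapT => nU.
  have : (~` U) (Some b) by [].
  rewrite UE => -[b' Cb [bb]]; apply: Mb; rewrite -bb.
  by have := metric_triangle b' c a; have := MC _ _ Cb Cc; lra.
exists 0 => b _; apply: contrapT => nU; have : (~` U) (Some b) by [].
by rewrite UE => -[c Cc _]; apply: C0; exists c.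
Qed.

Lemma natural_boundary_map : natural_map iota phi.
Proof.
split => [//|[x|zeta] U oU] /=.
  move=> /(ext_open_Some oU)[e e0 eU].
  have [r r0 rP] := mdist_lt_hyperbolization x e0.
  exists r => // y /rP xy; apply: eU.
  by rewrite mdist_completion metric_sym.
case E : (phi zeta) => [a|] Ua w.
  have [e e0 eU] := ext_open_Some oU Ua.
  have ab : mboundary iota a by apply: ideal_point_Some; rewrite -E.
  have [t t0 tP] := gromov_prod_near_mboundary w ab e0.
  exists t => // p /= /gromov_prod_ub_near[x [y [xp yz xy]]].
  rewrite E in yz; have [b] := tP _ _ _ xp yz xy.
  rewrite -/(extended_embedding p) => -> ba.
  exact: eU.
have [M MU] := ext_open_None (iota w) oU Ua.
have [t t0 tP] := gromov_prod_near_infty w M.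
exists t => // p /= /gromov_prod_ub_near[x [y [xp yz xy]]].
rewrite -/(extended_embedding p); rewrite E in yz.
case Ep : (extended_embedding p) => [b|//].
by apply: MU; apply: (tP x y) => //; rewrite -Ep.
Qed.

(** * Busemann functions and Hamenstädt metrics based at infinity *)

Context (xi : gboundary h) (xi_infty : phi xi = None).
Context (f : gboundary h -> Y) (phiE : forall z, z <> xi -> phi z = Some (f z)).

Lemma boundary_map_mboundary z : z <> xi -> mboundary iota (f z).
Proof. by move=> zxi; apply: ideal_point_Some; rewrite -phiE. Qed.

(** The remaining factor [u (y i) w / u x (y i)] tends to 1, since by [hsize_mdist] its terms differ
    by at most [2 * mdist x w] while the denominator is unbounded. *)
Lemma gromov_prod_infty_cvg w x y : tends y None ->
  gromov_prod h w x (y i) @[i --> \oo] --> ln (u x w / D w).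
Proof.
move=> yN; have w0 := bdist_pos w.
rewrite (_ : (fun i => _) =
    (fun i => ln (u x w / D w) + ln (u (y i) w / u x (y i)))); last first.
  apply/funext => i; rewrite gromov_prod_hyperbolization.
  by rewrite !ln_div ?lnM ?posrE ?mulr_gt0 ?hsize_gt0//; lra.
rewrite -[X in _ --> X]addr0; apply: cvgD; first exact: cvg_cst.
rewrite -[X in _ --> X]ln1.
suff H : u (y i) w / u x (y i) @[i --> \oo] --> (1 : R).
  exact: (cvg_comp _ _ H (continuous_ln ltr01)).
apply/cvgrPdist_lt => e e0; near=> i.
have q0 := hsize_gt0 x (y i).
have -> : 1 - u (y i) w / u x (y i) = (u x (y i) - u (y i) w) / u x (y i).
  by field; rewrite gt_eqF.
rewrite normrM normfV (gtr0_norm q0) ltr_pdivrMr// ltr_norml.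
have : 2 * mdist x w / e < u (y i) x by near: i; exact: tends_None_near.
rewrite ltr_pdivrMr// (hsizeC _ x) (hsizeC _ w).
have := hsize_mdist x w (y i); have := hsize_mdist w x (y i).
by rewrite (metric_sym w) => *; apply/andP; split; lra.
Unshelve. all: by end_near. Qed.

Lemma gromov_prod_pb_infty w x : gromov_prod_pb w x xi = (ln (u x w / D w))%:E.
Proof.
apply: ereal_inf_constant.
  by have [y yxi] := class_of_exists xi; eexists; exists y.
move=> _ [y yxi <-].
have yN : tends y None by move: yxi; rewrite class_ofE xi_infty.
exact: limn_einf_EFin (gromov_prod_infty_cvg yN).
Qed.

Lemma busemannE w x : busemann xi w x = ln (D w) - ln (D x).
Proof.
rewrite /busemann !gromov_prod_pb_infty/= !ln_div ?posrE ?hsize_gt0 ?bdist_pos//.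
by rewrite (hsizeC w); lra.
Qed.

Lemma busemann_prodE w x y :
  busemann_prod h (busemann xi w) x y = ln (D w) - ln (u x y).
Proof. by rewrite /busemann_prod !busemannE hyperbolizationE; lra. Qed.

(** The maximum in [u] vanishes in the limit, because [D (x i)] is at most the distance from [x i]
    to [a], and likewise for [y] and [b]. *)
Lemma hsize_cvg x y a b : mboundary iota a -> mboundary iota b ->
  tends x (Some a) -> tends y (Some b) ->
  u (x i) (y i) @[i --> \oo] --> mdist a b.
Proof.
move=> ab bb xa yb; apply/cvgrPdist_lt => e e0.
have e40 : 0 < e / 4 by rewrite divr_gt0.
near=> i.
have xae : mdist (iota (x i)) a < e / 4 by near: i; exact: tends_Some_near.
have ybe : mdist (iota (y i)) b < e / 4 by near: i; exact: tends_Some_near.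
have Dx := bdist_le_mdist (x i) ab; have Dy := bdist_le_mdist (y i) bb.
have Dx0 := bdist_pos (x i); have Dy0 := bdist_pos (y i).
have M0 : 0 <= Num.max (D (x i)) (D (y i)) by rewrite le_max ltW.
have Me : Num.max (D (x i)) (D (y i)) < e / 4 by rewrite gt_max; apply/andP; split; lra.
have := metric_triangle a (iota (x i)) b; rewrite (metric_sym a (iota _)).
have := metric_triangle (iota (x i)) (iota (y i)) b.
have := metric_triangle (iota (x i)) a (iota (y i)).
have := metric_triangle a b (iota (y i)); rewrite (metric_sym b (iota _)).
rewrite mdist_completion /hsize ltr_norml => *; apply/andP; split; lra.
Unshelve. all: by end_near. Qed.

Lemma busemann_prod_bbE w z1 z2 : z1 <> xi -> z2 <> xi ->
  busemann_prod_bb (busemann xi w) z1 z2 =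
  if f z1 == f z2 then +oo%E else (ln (D w) - ln (mdist (f z1) (f z2)))%:E.
Proof.
move=> z1xi z2xi; apply: ereal_inf_constant.
  have [x xz] := class_of_exists z1; have [y yz] := class_of_exists z2.
  by eexists; exists x => //; exists y.
move=> _ [x xz [y yz <-]].
have [b1 b2] := (boundary_map_mboundary z1xi, boundary_map_mboundary z2xi).
have xf : tends x (Some (f z1)) by move: xz; rewrite class_ofE phiE.
have yf : tends y (Some (f z2)) by move: yz; rewrite class_ofE phiE.
have uc := hsize_cvg b1 b2 xf yf.
case: eqVneq => [e|ne].
  suff H : (busemann_prod h (busemann xi w) (x i) (y i))%:E @[i --> \oo] --> +oo%E.
    by have [-> _] := cvg_limn_einf_sup H.
  apply/cvgeryP/cvgryPgt => A; move: uc; rewrite e mdistxx => /cvgrPdist_lt uc.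
  near=> i; rewrite busemann_prodE.
  have : `|0 - u (x i) (y i)| < D w / expR A.
    by near: i; apply: uc; rewrite divr_gt0 ?expR_gt0 ?bdist_pos.
  rewrite sub0r normrN gtr0_norm ?hsize_gt0// => lt1.
  have : ln (u (x i) (y i)) < ln (D w / expR A).
    by rewrite ltr_ln ?posrE ?hsize_gt0 ?divr_gt0 ?expR_gt0 ?bdist_pos.
  by rewrite ln_div ?posrE ?expR_gt0 ?bdist_pos// expRK; lra.
apply: limn_einf_EFin.
under eq_fun do rewrite busemann_prodE.
apply: cvgB; first exact: cvg_cst.
have d0 : 0 < mdist (f z1) (f z2) by rewrite mdist_gt0.
exact: (cvg_comp _ _ uc (continuous_ln d0)).
Unshelve. all: by end_near. Qed.

(** The power absorbs the case split on [f z1 == f z2]: an infinite product gives the exponential 0,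
    which is also the positive power of a zero distance. *)
Lemma hamenstadt_rhoE w eps z1 z2 : 0 < eps -> z1 <> xi -> z2 <> xi ->
  hamenstadt_rho (busemann xi w) eps z1 z2 =
  ((mdist (f z1) (f z2) / D w) `^ eps)%:E.
Proof.
move=> eps0 z1xi z2xi; rewrite /hamenstadt_rho busemann_prod_bbE//.
have w0 := bdist_pos w.
case: eqVneq => [->|ne].
  by rewrite gt0_muley ?lte_fin//= mdistxx mul0r powR0// gt_eqF.
have d0 : 0 < mdist (f z1) (f z2) by rewrite mdist_gt0.
rewrite -EFinM -EFinN /= /powR gt_eqF ?divr_gt0// ln_div ?posrE//.
by congr (expR _)%:E; lra.
Qed.

(** * Quasi-ultrametric inequality and two-sided bounds for the Hamenstädt metric *)

(** In the four-point inequality based at a far [w], the terms [ln (u x w)] and [ln (u y w)] exceed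
    [ln (u z w)] only slightly. The gap between [expR delta] and [L] absorbs the excess, so one far
    point replaces a limit. *)
Lemma hsize_quasimetric (unb : ~ bounded_mset [set: X]) delta L x y z :
  gromov_hyperbolic h delta -> expR delta < L ->
  u x y <= L * Num.max (u x z) (u z y).
Proof.
move=> hyp dL; have L0 : 0 < L := lt_trans (expR_gt0 _) dL.
pose s := L / expR delta.
have s1 : 0 < s - 1 by rewrite subr_gt0 ltr_pdivlMr ?expR_gt0// mul1r.
have s0 : 0 < s by lra.
(* So far out, moving from [z] to [x] or [y] multiplies [u z w] by at most [s]. *)
have [w wz] : exists w, 2 * (mdist x z + mdist y z) / (s - 1) < u w z.
  have [v vN] := @tends_exists unb None (or_introl erefl).
  by have [i] := filter_ex (tends_None_near z (2 * (mdist x z + mdist y z) / (s - 1)) vN);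
    exists (v i).
have far v : mdist v z <= mdist x z + mdist y z ->
    ln (u v w) <= ln (u z w) + ln L - delta.
  move=> vz.
  have -> : ln (u z w) + ln L - delta = ln (s * u z w).
    rewrite lnM ?posrE ?hsize_gt0// ln_div ?posrE ?expR_gt0// expRK; lra.
  rewrite ler_ln ?posrE ?hsize_gt0//; last by apply: mulr_gt0 => //; exact: hsize_gt0.
  move: wz; rewrite ltr_pdivrMr// (hsizeC w); have := hsize_mdist v z w; lra.
have farx : ln (u x w) <= ln (u z w) + ln L - delta.
  by apply: far; rewrite lerDl mdist_ge0.
have fary : ln (u y w) <= ln (u z w) + ln L - delta.
  by apply: far; rewrite lerDr mdist_ge0.
have lnuE v v' : ln (u v v') <= ln L + ln (u x z) \/ ln (u v v') <= ln L + ln (u z y) ->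
    u v v' <= L * Num.max (u x z) (u z y).
  rewrite -!lnM ?posrE ?hsize_gt0// !ler_ln ?posrE ?mulr_gt0 ?hsize_gt0//.
  by case=> /le_trans; apply; rewrite ler_pM2l// le_max lexx ?orbT.
apply: lnuE; have := hyp x y z w.
rewrite lerBlDr ge_min /gromov_prod !hyperbolizationE => /orP[] ?.
  by left; lra.
by right; lra.
Qed.

Lemma mboundary_quasimetric (unb : ~ bounded_mset [set: X]) delta L a b c :
  gromov_hyperbolic h delta -> expR delta < L ->
  mboundary iota a -> mboundary iota b -> mboundary iota c ->
  mdist a b <= L * Num.max (mdist a c) (mdist c b).
Proof.
move=> hyp dL ab bb cb; have L0 : 0 < L := lt_trans (expR_gt0 _) dL.
have ex d : mboundary iota d -> exists x, tends x (Some d).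
  by move=> db; apply: (tends_exists unb); right; exists d.
have [x xa] := ex _ ab; have [y yb] := ex _ bb; have [z zc] := ex _ cb.
have /cvgrPdist_lt uxy := hsize_cvg ab bb xa yb.
have /cvgrPdist_lt uxz := hsize_cvg ab cb xa zc.
have /cvgrPdist_lt uzy := hsize_cvg cb bb zc yb.
apply/ler_addgt0Pl => e e0.
have e20 : 0 < e / 2 by rewrite divr_gt0.
have eL0 : 0 < e / 2 / L by rewrite divr_gt0.
set M := Num.max (mdist a c) (mdist c b).
have : \forall i \near \oo, mdist a b <= e + L * M; last by move=> /filter_ex[].
near=> i.
have hxy : `|mdist a b - u (x i) (y i)| < e / 2 by near: i; exact: uxy.
have hxz : `|mdist a c - u (x i) (z i)| < e / 2 / L by near: i; exact: uxz.
have hzy : `|mdist c b - u (z i) (y i)| < e / 2 / L by near: i; exact: uzy.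
have Mac : mdist a c <= M by rewrite le_max lexx.
have Mcb : mdist c b <= M by rewrite le_max lexx orbT.
have : u (x i) (y i) <= L * (M + e / 2 / L).
  apply: le_trans (hsize_quasimetric unb (x i) (y i) (z i) hyp dL) _.
  rewrite ler_pM2l// ge_max.
  by move: hxz hzy; rewrite !ltr_norml => /andP[? ?] /andP[? ?]; apply/andP; split; lra.
rewrite mulrDr [L * (_ / L)]mulrC divfK ?gt_eqF//.
by move: hxy; rewrite ltr_norml => /andP[? ?]; lra.
Unshelve. all: by end_near. Qed.

Lemma hamenstadt_bounds (unb : ~ bounded_mset [set: X]) delta eps w z1 z2 :
  gromov_hyperbolic h delta -> admissible delta eps -> z1 <> xi -> z2 <> xi ->
  (mdist (f z1) (f z2) / D w) `^ eps / 2 <= hamenstadt xi (busemann xi w) eps z1 z2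
    <= (mdist (f z1) (f z2) / D w) `^ eps.
Proof.
move=> hyp [eps0 adm] z1xi z2xi.
have w0 := bdist_pos w.
pose r z z' := (mdist (f z) (f z') / D w) `^ eps.
(* Chosen so that its power [K] with exponent [eps] is the square root of 2, the largest constant
   allowed in [chain_quasimetric]. Admissibility gives [22 * eps * delta <= ln 2], hence
   [expR delta < L]. *)
pose L : R := expR (ln 2 / (2 * eps)).
have dL : expR delta < L.
  have ln20 : 0 < ln 2 :> R by rewrite ln_gt0// ltr1n.
  rewrite ltr_expR ltr_pdivlMr ?mulr_gt0//.
  have : 22 * eps * delta <= ln 2.
    by rewrite -(expRK (22 * eps * delta)) ler_ln ?posrE ?expR_gt0.
  lra.
have L0 : 0 < L := expR_gt0 _.
pose K : R := L `^ eps.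
have K2 : K * K = 2.
  rewrite /K /powR gt_eqF// /L expRK -expRD.
  have -> : eps * (ln 2 / (2 * eps)) + eps * (ln 2 / (2 * eps)) = ln 2.
    by field; rewrite gt_eqF.
  by rewrite lnK// posrE.
have rK z z' z'' : z <> xi -> z' <> xi -> z'' <> xi ->
    r z z' <= K * Num.max (r z z'') (r z'' z').
  move=> zxi z'xi z''xi.
  have q := mboundary_quasimetric unb hyp dL (boundary_map_mboundary zxi)
    (boundary_map_mboundary z'xi) (boundary_map_mboundary z''xi).
  have rle v : mdist (f z) (f z') <= L * v -> 0 <= v -> r z z' <= K * (v / D w) `^ eps.
    move=> le1 v0; rewrite -powRM ?(ltW L0) ?divr_ge0 ?(ltW w0)//.
    apply: ge0_ler_powR; rewrite ?nnegrE ?(ltW eps0)//.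
    - by rewrite divr_ge0 ?mdist_ge0 ?ltW.
    - by rewrite mulr_ge0 ?divr_ge0 ?(ltW L0) ?(ltW w0).
    - by rewrite mulrA ler_pM2r ?invr_gt0.
  apply: le_trans (rle _ q _) _; first by rewrite le_max mdist_ge0.
  rewrite ler_pM2l ?powR_gt0//.
  by rewrite /Num.max; case: ifP => _; rewrite le_max lexx ?orbT.
have lo : ((r z1 z2 / 2)%:E <= ereal_inf (chain_sums xi (busemann xi w) eps z1 z2))%E.
  apply: le_ereal_inf_tmp => _ [n [c [n0 c0 cn cxi ->]]].
  have -> : (\sum_(i < n) hamenstadt_rho (busemann xi w) eps (c i) (c i.+1))%E =
      (\sum_(i < n) r (c i) (c i.+1))%:E.
    rewrite -sumEFin; apply: eq_bigr => i _.
    by rewrite hamenstadt_rhoE//; apply: cxi => //; exact: ltnW.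
  rewrite lee_fin ler_pdivrMr// mulrC -c0 -cn.
  apply: (@chain_quasimetric _ (fun i j => r (c i) (c j)) K).
  - by rewrite K2.
  - exact: powR_ge0.
  - by move=> i j; exact: powR_ge0.
  - by move=> i; rewrite /r mdistxx mul0r powR0// gt_eqF.
  - by move=> i j k iN jN kN; apply: rK; exact: cxi.
have up : (ereal_inf (chain_sums xi (busemann xi w) eps z1 z2) <= (r z1 z2)%:E)%E.
  (* The chain with a single link gives the upper bound. *)
  apply: ereal_inf_lbound; exists 1%N, (fun i => if i is 0%N then z1 else z2).
  split => //; first by case.
  by rewrite big_ord_recl big_ord0 adde0 hamenstadt_rhoE.
rewrite -/(r z1 z2) /hamenstadt.
(* The two real bounds exclude infinite values, so [fine] returns the infimum itself. *)
case: (ereal_inf _) lo up => [v| |] //=.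
by rewrite !lee_fin => -> ->.
Qed.

Lemma boundary_map_bij (unb : ~ bounded_mset [set: X]) :
  set_bij (~` [set xi]) (mboundary iota) f.
Proof.
split.
- by move=> z zxi; exact: boundary_map_mboundary.
- move=> z1 z2 /set_mem z1xi /set_mem z2xi e.
  by apply: boundary_map_inj; rewrite !phiE// e.
- move=> a ab; have [|z za] := @boundary_map_surj unb (Some a).
    by right; exists a.
  have zxi : z <> xi by move=> e; move: za; rewrite e xi_infty.
  by exists z => //; move: za; rewrite phiE// => -[].
Qed.

(** The factor 2 in the distortion function is the ratio of the two bounds in [hamenstadt_bounds].
    The scale [D w] cancels between the two distances compared, so the base point leaves no
    trace. *)
Lemma boundary_map_quasisymmetric (unb : ~ bounded_mset [set: X]) delta eps w :
  gromov_hyperbolic h delta -> admissible delta eps ->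
  quasisymmetric (fun t => (2 * t) `^ eps^-1)
    (~` [set xi]) (hamenstadt xi (busemann xi w) eps) (mboundary iota) mdist f.
Proof.
move=> hyp adm; have [eps0 _] := adm; have w0 := bdist_pos w.
have epsV0 : 0 < eps^-1 by rewrite invr_gt0.
pose d z z' := mdist (f z) (f z') / D w.
have d0 z z' : 0 <= d z z' by rewrite divr_ge0 ?mdist_ge0// ltW.
have B z1 z2 (z1xi : z1 <> xi) (z2xi : z2 <> xi) :=
  andP (hamenstadt_bounds unb w hyp adm z1xi z2xi).
have powK v : 0 <= v -> (v `^ eps) `^ eps^-1 = v.
  by move=> v0; rewrite -powRrM mulfV ?gt_eqF// powRr1.
have powKV v : 0 <= v -> (v `^ eps^-1) `^ eps = v.
  by move=> v0; rewrite -powRrM mulVf ?gt_eqF// powRr1.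
have nn v : 0 <= v -> v \in Num.nneg by [].
split.
- exact: homeo_halfline_powR.
- split; first exact: boundary_map_bij.
  + move=> z1 z1xi e e0.
    exists ((e / D w) `^ eps / 2); first by rewrite divr_gt0// powR_gt0// divr_gt0.
    move=> z2 z2xi; have [lo _] := B _ _ z1xi z2xi => /(le_lt_trans lo).
    rewrite ltr_pM2r ?invr_gt0// => lt1.
    have : d z1 z2 < e / D w.
      rewrite ltNge; apply/negP => le1; move: lt1; rewrite ltNge => /negP; apply.
      by apply: ge0_ler_powR; rewrite ?nnegrE ?d0 ?divr_ge0 ?(ltW e0) ?(ltW w0) ?(ltW eps0).
    by rewrite ltr_pM2r ?invr_gt0.
  + move=> z1 z1xi e e0.
    exists (e `^ eps^-1 * D w); first by rewrite mulr_gt0// powR_gt0.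
    move=> z2 z2xi; have [_ up] := B _ _ z1xi z2xi => lt1.
    apply: le_lt_trans up _; rewrite -(powKV e) ?ltW//.
    apply: gt0_ltr_powR => //; rewrite ?nnegrE ?powR_ge0//; first exact: d0.
    by rewrite ltr_pdivrMr.
- move=> t z1 z2 z3 t0 z1xi z2xi z3xi le1.
  have [lo _] := B _ _ z1xi z2xi; have [_ up] := B _ _ z1xi z3xi.
  have : d z1 z2 `^ eps <= 2 * t * d z1 z3 `^ eps.
    rewrite -mulrA mulrC -ler_pdivrMr//; apply: le_trans lo _; apply: le_trans le1 _.
    by rewrite ler_pM2l.
  have t20 : 0 <= 2 * t by rewrite mulr_ge0// ltW.
  move=> le2.
  have : (d z1 z2 `^ eps) `^ eps^-1 <= (2 * t * d z1 z3 `^ eps) `^ eps^-1.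
    apply: ge0_ler_powR; rewrite ?nnegrE ?powR_ge0 ?(ltW epsV0)//.
    by rewrite mulr_ge0// powR_ge0.
  rewrite (powRM _ t20) ?powR_ge0// !powK//.
  by rewrite /d mulrA ler_pM2r ?invr_gt0.
Qed.

End boundary_map.

End gromov_boundary_of_hyperbolization.

Theorem theorem1p1 (R : realType) :
  exists eta : R -> R -> R,
  forall (X Y : metricType R) (iota : X -> Y),
    is_completion iota ->
    ~ bounded_mset [set: X] ->
    locally_complete X ->
    mboundary iota !=set0 ->
    let h := hyperbolization iota in
    exists (phi : gboundary h -> option Y) (xi : gboundary h) (f : gboundary h -> Y),
      [/\ natural_map iota phi,
          phi xi = None,
          forall zeta, zeta <> xi -> phi zeta = Some (f zeta)
        & forall (b : X -> R) (delta eps : R),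
            busemann_functions xi b ->
            0 <= delta -> gromov_hyperbolic h delta -> admissible delta eps ->
            quasisymmetric (eta eps)
              (~` [set xi]) (hamenstadt xi b eps)
              (mboundary iota) mdist
              f].
Proof.
(* Fixing the function before the space is introduced makes it depend on [eps] alone. *)
exists (fun eps t => (2 * t) `^ eps^-1) => X Y iota iotaP unb lcX incX h.
have /choice[phi phiP] := class_of_tends iotaP lcX incX.
have ideal z : ideal_point iota (phi z) by have [] := phiP z.
have classE z : class_of z = [set x | tends iota x (phi z)] by have [] := phiP z.
have [xi xiN] := boundary_map_surj iotaP lcX incX ideal classE unb (or_introl erefl).
(* The default [y0] is taken only at [xi], the one class sent to infinity. *)
have [y0 _] := incX; pose f z := odflt y0 (phi z).
have phiE z : z <> xi -> phi z = Some (f z).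
  move=> zxi; rewrite /f; case E : (phi z) => [//|].
  by case: zxi; apply: (boundary_map_inj classE); rewrite E xiN.
exists phi, xi, f; split => //; first exact: natural_boundary_map.
by move=> b delta eps [w _ <-] _ hyp adm; exact: (boundary_map_quasisymmetric
  iotaP lcX incX ideal classE xiN phiE unb w hyp adm).
Qed.
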